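(* Let $E$ be a closed subset of the unit circle $\mathbb{T}$ of Lebesgue measure zero. Then there exists a sequence $(u_n)_{n\ge1}$ of positive real numbers with $u_n\to\infty$ and with the following property: if $T$ is a bounded linear operator on a complex Hilbert space such that $\|T\|\le 1$, $\sigma(T)\subset E$, $\|T^{-n}\|=O(u_n)$ as $n\to\infty$, and $\operatorname{rank}(I-T^*T)<\infty$, then $T$ is a unitary operator.
   Context: $\mathbb{T}=\{z\in\mathbb{C}:|z|=1\}$, and $\sigma(T)$ denotes the spectrum of $T$. Since $\sigma(T)\subset\mathbb{T}$, $T$ is invertible, and $T^{-n}=(T^{-1})^n$. The condition $\operatorname{rank}(I-T^*T)<\infty$ means that the range of $I-T^*T$ is finite-dimensional. The sequence $(u_n)$ depends only on $E$, not on $T$ or on the Hilbert space. *)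

(* Defs.v *)
From HB Require Import structures.
From mathcomp Require Import all_boot all_order all_algebra sesquilinear.
From mathcomp Require Import complex.
From mathcomp Require Import all_classical all_reals all_analysis.

Set Implicit Arguments.
Unset Strict Implicit.
Unset Printing Implicit Defensive.

Import Order.TTheory GRing.Theory Num.Theory.
Import numFieldNormedType.Exports.

Local Open Scope classical_set_scope.
Local Open Scope ring_scope.
Local Open Scope complex_scope.

(* The modulus topology on the complex numbers R[i]: the library puts it on
   every numFieldType, but canonical inference does not find it on the
   concrete carrier R[i]. *)
HB.instance Definition _ (R : realType) := NormedModule.copy R[i] (R[i]^o).

(* The inner product is linear in its first argument and conjugate-linear in
   the second. *)
HB.mixin Record CompleteNormedModule_isHilbert (R : realType) (V : Type)
    of CompleteNormedModule R[i] V := {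
  inner : {dot V for (@Num.conj R[i])} ;
  innerE : forall x : V, inner x x = `|x| ^+ 2
}.

#[short(type="hilbertType")]
HB.structure Definition Hilbert (R : realType) :=
  { V of CompleteNormedModule_isHilbert R V & CompleteNormedModule R[i] V }.

Section circle.
Variable R : realType.

Definition unit_circle : set R[i] := [set z | `|z| = 1].

Definition expi (t : R) : R[i] := cos t +i* sin t.

(* Arc length: pushforward of Lebesgue measure on [0, 2 pi[ by t |-> e^{it}. *)
Definition circle_measure (A : set R[i]) : \bar R :=
  @lebesgue_measure R (expi @^-1` A `&` [set` `[0, pi *+ 2[ ]).

End circle.

Section operators.
Variables (R : realType) (H : hilbertType R).
Implicit Types (T S : H -> H) (V : set H).

Definition bounded_op T :=
  linear T /\ exists M : R, forall x, `|T x| <= M%:C * `|x|.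

(* The library norm of H takes its values in R[i]; they are nonnegative reals,
   hence the real part. *)
Definition opnorm T : R :=
  sup [set complex.Re `|T x| | x in [set x : H | `|x| <= 1]].

Definition is_inverse T S := [/\ bounded_op S, cancel T S & cancel S T].

Definition invertible_op T := exists S, is_inverse T S.

(* When T is not invertible the value is the junk value id. *)
Definition inverse_op T : H -> H := xget (id : H -> H) (is_inverse T).

Definition spectrum T : set R[i] :=
  [set l | ~ invertible_op (fun x => T x - l *: x)].

Definition is_adjoint T S :=
  bounded_op S /\ forall x y, inner (T x) y = inner x (S y).

(* By the Riesz representation theorem a bounded T has exactly one adjoint, so
   the default value id is never taken. *)
Definition adjoint T : H -> H := xget (id : H -> H) (is_adjoint T).

Definition finite_dimensional V :=
  exists (n : nat) (e : 'I_n -> H),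
    V = range (fun c : 'I_n -> R[i] => \sum_i c i *: e i).

Definition unitary T := cancel T (adjoint T) /\ cancel (adjoint T) T.

End operators.

(* Main.v *)
Require Import Defs.
From HB Require Import structures.
From mathcomp Require Import all_boot all_order all_algebra sesquilinear.
From mathcomp Require Import complex ring lra zify.
From mathcomp Require Import all_classical all_reals all_analysis.
Import Order.TTheory GRing.Theory Num.Theory.
Import numFieldNormedType.Exports.
Local Open Scope classical_set_scope.
Local Open Scope ring_scope.
Local Open Scope complex_scope.

(** Fix [x] with [q := |x|^2 - |T x|^2 > 0] and put [b k := q(T^k x, x)] for all
    integers [k], where [q(y, w) := <y, w> - <T y, T w>] is positive semidefinite.
    By Cauchy-Schwarz [|b k|^2 <= q (|T^k x|^2 - |T^(k+1) x|^2)], so square sums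
    of [b] telescope, and they grow slowly on negative indices because
    [|T^-n| = O(u n)].  The Fejer means of [sum_k b k e^{-ikt}] tend to [0]
    uniformly on arcs away from [E], since they are controlled by the resolvent of
    [T]; so [b] is the coefficient sequence of a distribution supported in the
    null set [E].  Cutting the circle into [M] arcs, of which only a small
    fraction meets [E], and pairing with the indicator of the arcs meeting [E],
    whose coefficients [c] have small square sum and are [O(M / k)], gives
    [b 0 = 0] provided [u] grows slowly enough in terms of [E] alone.  But
    [b 0 = q(x, x)].  All integrals over the circle are replaced by averages over
    roots of unity. *)

(** * Real-valued norm and linear maps *)

Definition nm {R : realType} {V : normedZmodType R[i]} (x : V) : R :=
  complex.Re `|x|.

Lemma nmE {R : realType} {V : normedZmodType R[i]} (x : V) : `|x| = (nm x)%:C.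
Proof. by rewrite /nm RRe_real// normr_real. Qed.

Lemma nm_ge0 {R : realType} {V : normedZmodType R[i]} (x : V) : 0 <= nm x.
Proof. by rewrite -ler0c -nmE. Qed.

Lemma nm_eq0 {R : realType} {V : normedZmodType R[i]} (x : V) :
  (nm x == 0) = (x == 0).
Proof. by rewrite -[RHS]normr_eq0 nmE -(inj_eq (@complexI R)). Qed.

Lemma nm0 {R : realType} {V : normedZmodType R[i]} : nm (0 : V) = 0.
Proof. by apply/eqP; rewrite nm_eq0. Qed.

Lemma ler_nmD {R : realType} {V : normedZmodType R[i]} (x y : V) :
  nm (x + y) <= nm x + nm y.
Proof. by rewrite -lecR rmorphD/= -!nmE ler_normD. Qed.

Lemma nmN {R : realType} {V : normedZmodType R[i]} (x : V) : nm (- x) = nm x.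
Proof. by rewrite /nm normrN. Qed.

Lemma ler_nmB {R : realType} {V : normedZmodType R[i]} (x y : V) :
  nm (x - y) <= nm x + nm y.
Proof. by rewrite -(nmN y) ler_nmD. Qed.

Lemma ler_nm_sum {R : realType} {V : normedZmodType R[i]} (I : Type)
    (r : seq I) (P : pred I) (F : I -> V) :
  nm (\sum_(i <- r | P i) F i) <= \sum_(i <- r | P i) nm (F i).
Proof.
elim/big_ind2: _ => [|x a y b xa yb|//]; first by rewrite nm0.
by apply: le_trans (ler_nmD _ _) _; exact: lerD.
Qed.

Lemma nmM {R : realType} (z w : R[i]) : nm (z * w) = nm z * nm w.
Proof. by apply: (@complexI R); rewrite rmorphM/= -!nmE normrM. Qed.

Lemma nmZ {R : realType} {V : normedModType R[i]} (z : R[i]) (x : V) :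
  nm (z *: x) = nm z * nm x.
Proof. by apply: (@complexI R); rewrite rmorphM/= -!nmE normrZ. Qed.

Lemma nm_real {R : realType} (x : R) : nm x%:C = `|x|.
Proof. by rewrite /nm normc_def/= expr0n/= addr0 sqrtr_sqr. Qed.

Lemma nm_nat {R : realType} (n : nat) : nm (n%:R : R[i]) = n%:R.
Proof.
by have := nm_real (n%:R : R); rewrite rmorph_nat ger0_norm.
Qed.

Lemma nmX {R : realType} (z : R[i]) n : nm (z ^+ n) = nm z ^+ n.
Proof.
elim: n => [|n IHn]; last by rewrite !exprS nmM IHn.
by rewrite !expr0 (nm_nat 1).
Qed.

Lemma nmV {R : realType} (z : R[i]) : nm z^-1 = (nm z)^-1.
Proof.
have [->|z0] := eqVneq z 0; first by rewrite invr0 nm0 invr0.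
have n0 : nm z != 0 by rewrite nm_eq0.
by apply: (mulfI n0); rewrite -nmM divff// divff// (nm_nat 1).
Qed.

Lemma nm_sqr {R : realType} (z : R[i]) : (nm z ^+ 2)%:C = z * (z^*)%C.
Proof. by rewrite rmorphXn/= -nmE sqr_normc. Qed.

Section linear_maps.
Variables (R : realType) (H : hilbertType R) (T : H -> H).
Hypothesis linT : linear T.

Lemma lin_add x y : T (x + y) = T x + T y.
Proof. by have := linT 1 x y; rewrite !scale1r. Qed.

Lemma lin0 : T 0 = 0.
Proof.
by have := lin_add 0 0; rewrite addr0 => /(congr1 (+%R^~ (- T 0))); rewrite addrK subrr.
Qed.

Lemma lin_scale a x : T (a *: x) = a *: T x.
Proof. by have := linT a x 0; rewrite !addr0 lin0 addr0. Qed.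

Lemma lin_sub x y : T (x - y) = T x - T y.
Proof. by rewrite lin_add -scaleN1r lin_scale scaleN1r. Qed.

Lemma lin_sum (I : Type) (r : seq I) (Q : pred I) (F : I -> H) :
  T (\sum_(i <- r | Q i) F i) = \sum_(i <- r | Q i) T (F i).
Proof. exact: (big_morph _ lin_add lin0). Qed.

End linear_maps.

Arguments lin_add {R H T}.
Arguments lin0 {R H T}.
Arguments lin_scale {R H T}.
Arguments lin_sub {R H T}.
Arguments lin_sum {R H T}.

(** * The defect form of a contraction *)

Section defect_form.
Variables (R : realType) (H : hilbertType R) (T : H -> H).
Hypothesis linT : linear T.
Hypothesis contrT : forall x, nm (T x) <= nm x.

Definition defect (y w : H) : R[i] := inner y w - inner (T y) (T w).

Lemma defectDl y z w : defect (y + z) w = defect y w + defect z w.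
Proof. rewrite /defect (lin_add linT) !linearDl/=; ring. Qed.

Lemma defectZl a y w : defect (a *: y) w = a * defect y w.
Proof. rewrite /defect (lin_scale linT) !linearZl/=; ring. Qed.

Lemma defectDr y z w : defect w (y + z) = defect w y + defect w z.
Proof. rewrite /defect (lin_add linT) !linearDr/=; ring. Qed.

Lemma defectZr a y w : defect w (a *: y) = (a^*)%C * defect w y.
Proof. rewrite /defect (lin_scale linT) !linearZr_LR/=. ring. Qed.

Lemma defectC y w : defect y w = ((defect w y)^*)%C.
Proof.
rewrite /defect rmorphB/= hermC /= expr0 mul1r; congr (_ - _).
by rewrite hermC /= expr0 mul1r.
Qed.

Lemma defect_sum (I : Type) (r : seq I) (P : pred I) (a : I -> R[i]) (F : I -> H) w :
  defect (\sum_(i <- r | P i) a i *: F i) w = \sum_(i <- r | P i) a i * defect (F i) w.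
Proof.
elim/big_rec2: _ => [|i u v _ IH]; first by rewrite /defect (lin0 linT) !linear0l subr0.
by rewrite defectDl IH defectZl.
Qed.

Lemma defectE y : defect y y = (nm y ^+ 2 - nm (T y) ^+ 2)%:C.
Proof. by rewrite /defect !innerE !nmE rmorphB/= !rmorphXn. Qed.

Lemma defect_ge0 y : 0 <= nm y ^+ 2 - nm (T y) ^+ 2.
Proof. by rewrite subr_ge0 ler_sqr ?nnegrE ?nm_ge0. Qed.

(** Positivity of the form at [y - (b / q) x], where [b = defect y x] and [q = defect x x], expands
    to [defect y y - |b|^2 / q >= 0]. *)
Lemma defect_CauchySchwarz y x : 0 < nm x ^+ 2 - nm (T x) ^+ 2 ->
  nm (defect y x) ^+ 2 <=
  (nm y ^+ 2 - nm (T y) ^+ 2) * (nm x ^+ 2 - nm (T x) ^+ 2).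
Proof.
set qx := _ - _ => qx0; set qy := _ - _.
have := defect_ge0 (y + (- (defect y x / qx%:C)) *: x).
rewrite -ler0c -defectE defectDl !defectDr !defectZl !defectZr.
rewrite !defectE -/qx -/qy (defectC x y).
set b := defect y x.
have qxC0 : qx%:C != 0 by rewrite eq_complex/= gt_eqF.
have -> : ((- (b / qx%:C))^*)%C = - ((b^*)%C / qx%:C).
  have Vr : ((qx%:C)^-1^*)%C = (qx%:C)^-1 by rewrite conjc_inv conjc_real.
  by rewrite -[in RHS]Vr -rmorphM -rmorphN.
have -> : qy%:C + - ((b^*)%C / qx%:C) * b +
    (- (b / qx%:C) * (b^*)%C + - (b / qx%:C) * (- ((b^*)%C / qx%:C) * qx%:C)) =
    qy%:C - (b * (b^*)%C) / qx%:C by field.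
rewrite -nm_sqr -[_^-1]fmorphV -rmorphM -rmorphB/= ler0c subr_ge0.
by rewrite ler_pdivrMr.
Qed.

(** A form with zero diagonal, evaluated at [x + d *: y] with [d = defect x y], leaves
    [2 |d|^2 = 0]. *)
Lemma defect_eq0 : (forall x, nm (T x) = nm x) -> forall x y, defect x y = 0.
Proof.
move=> isoT x y; have q0 z : defect z z = 0 by rewrite defectE isoT subrr.
have := q0 (x + defect x y *: y).
rewrite defectDl !defectDr !defectZl !defectZr !q0 (defectC y x).
rewrite add0r !mulr0 addr0 [X in X + _]mulrC -mulr2n -nm_sqr => /eqP.
rewrite mulrn_eq0/= eq_complex/= eqxx andbT sqrf_eq0 nm_eq0.
by move/eqP.
Qed.

End defect_form.

Arguments defect {R H}.

(** * Fejer sums of an orbit under a resolvent bound *)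

Section fejer.
Variables (R : realType) (H : hilbertType R) (T : H -> H).
Hypothesis linT : linear T.

Variable P : int -> H.
Hypothesis TP : forall k, T (P k) = P (k + 1).

Variables (z : R[i]) (rho : R).
Hypothesis z1 : nm z = 1.
Hypothesis rho0 : 0 <= rho.
Hypothesis below : forall y, nm y <= rho * nm (T y - z^-1 *: y).

Let z0 : z != 0.
Proof. by rewrite -nm_eq0 z1 oner_eq0. Qed.

Let Y (k : int) : H := (z ^ k) *: P k.

(** This is [- z (T - z^-1)], so [below] bounds it from below with the same constant, as [|z| = 1];
    on the weighted orbit [Y] it acts as a difference. *)
Let shift (y : H) : H := y - z *: T y.

Let shiftY k : shift (Y k) = Y k - Y (k + 1).
Proof.
by rewrite /shift /Y (lin_scale linT) TP scalerA expfzDr// expr1z [z * _]mulrC.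
Qed.

Let shiftB u v : shift (u - v) = shift u - shift v.
Proof. by rewrite /shift (lin_sub linT) scalerBr opprD addrACA -opprD. Qed.

Let shift_sum n (F : 'I_n -> H) :
  shift (\sum_(i < n) F i) = \sum_(i < n) shift (F i).
Proof. by rewrite /shift (lin_sum linT) scaler_sumr -sumrB. Qed.

Let shift_below y : nm y <= rho * nm (shift y).
Proof.
apply: le_trans (below y) _; rewrite ler_wpM2l// /shift.
have -> : T y - z^-1 *: y = - (z^-1 *: (y - z *: T y)).
  by rewrite scalerBr scalerA mulVf// scale1r opprB.
by rewrite nmN nmZ nmV z1 invr1 mul1r.
Qed.

(* With X = z T the double sum is X^-n (1 + X + ... + X^n)^2, so applying
   (1 - X)^2 telescopes it. *)
Lemma fejer_bound n :
  nm (\sum_(j < n.+1) \sum_(i < n.+1) z ^ (i%:Z - j%:Z) *: P (i%:Z - j%:Z))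
  <= rho ^+ 2 * (nm (P (- n%:Z)) + nm (P 1) *+ 2 + nm (P n.+2%:Z)).
Proof.
set V := \sum_(j < _) _.
have shV : shift V = (\sum_(j < n.+1) Y (- j%:Z)) - \sum_(j < n.+1) Y (n.+1%:Z - j%:Z).
  rewrite shift_sum -sumrB; apply: eq_bigr => j _.
  rewrite shift_sum; under eq_bigr do rewrite shiftY.
  rewrite -(big_mkord xpredT (fun i => Y (i%:Z - j%:Z) - Y (i%:Z - j%:Z + 1))).
  under eq_bigr => i _.
    rewrite (_ : Y _ - Y _ = - (Y (i.+1%:Z - j%:Z) - Y (i%:Z - j%:Z))); last first.
      by rewrite opprB; congr (_ - Y _); move: (val j) => j'; lia.
    over.
  by rewrite sumrN telescope_sumr// opprB sub0r.
have shs m : shift (\sum_(j < n.+1) Y (m - j%:Z)) = Y (m - n%:Z) - Y (m + 1).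
  rewrite shift_sum; under eq_bigr do rewrite shiftY.
  rewrite -(big_mkord xpredT (fun j => Y (m - j%:Z) - Y (m - j%:Z + 1))).
  under eq_bigr => i _.
    rewrite (_ : Y _ - Y _ = Y (m + 1 - i.+1%:Z) - Y (m + 1 - i%:Z)); last first.
      by congr (Y _ - Y _); lia.
    over.
  by rewrite telescope_sumr//; congr (Y _ - Y _); lia.
have shshV : shift (shift V) = (Y (- n%:Z) - Y 1) - (Y 1 - Y n.+2%:Z).
  rewrite shV shiftB; congr (_ - _).
    under eq_bigr do rewrite -sub0r.
    by rewrite shs; congr (Y _ - Y _); lia.
  by rewrite shs; congr (Y _ - Y _); lia.
have nY k : nm (Y k) = nm (P k).
  rewrite /Y nmZ -[RHS]mul1r; congr (_ * _).
  by case: k => m; rewrite ?NegzE -?exprnN ?nmV ?nmX ?z1 ?expr1n ?invr1 // -exprnP nmX z1 expr1n.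
(* Each removal of [shift] costs a factor [rho], and two of them recover [V]. *)
apply: le_trans (shift_below _) _; rewrite expr2 -mulrA ler_wpM2l//.
apply: le_trans (shift_below _) _; rewrite ler_wpM2l// shshV.
apply: le_trans (ler_nmB _ _) _.
apply: le_trans (lerD (ler_nmB _ _) (ler_nmB _ _)) _.
by rewrite !nY mulr2n !addrA.
Qed.

End fejer.

(** * The circle and roots of unity *)

Section expi_theory.
Variable R : realType.
Implicit Types t : R.

Lemma expi0 : expi (0 : R) = 1.
Proof. by rewrite /expi cos0 sin0. Qed.

Lemma expiD t u : expi (t + u) = expi t * expi u.
Proof. by rewrite /expi cosD sinD; simpc; congr (_ +i* _); rewrite addrC. Qed.

Lemma expiM_nat t n : expi (t * n%:R) = expi t ^+ n.
Proof.
elim: n => [|n IHn]; first by rewrite mulr0 expi0 expr0.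
by rewrite -natr1 mulrDr mulr1 expiD IHn exprSr.
Qed.

Lemma nm_expi t : nm (expi t) = 1.
Proof. by rewrite /nm normc_def/= cos2Dsin2 sqrtr1. Qed.

Lemma expi_2pi : expi (pi *+ 2 : R) = 1.
Proof. by rewrite /expi cos2pi sin2pi. Qed.

Lemma expi_neq1 t : 0 < t < pi *+ 2 -> expi t != 1.
Proof.
move=> /andP[t0 t2]; apply/negP => /eqP[cos1 _].
have st : 0 < sin (t / 2).
  by apply: sin_gt0_pi; rewrite divr_gt0//= ltr_pdivrMr// mulr_natr.
have := cos_mulr2n (t / 2); rewrite -[_ / 2 *+ 2]mulr_natr divfK// cos1.
move=> /eqP; rewrite cos2sin2; move: st; set s := sin _ => st.
by apply/negP; rewrite gt_eqF//; nra.
Qed.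

Lemma cos_piquarter_ge : 2^-1 <= cos (pi / 4) :> R.
Proof.
have c0 : 0 < cos (pi / 4 : R).
  by apply: cos_gt0_pihalf; have := pi_gt0 R; lra.
have := cos_mulr2n (pi / 4 : R).
have -> : pi / 4 *+ 2 = pi / 2 :> R by rewrite mulr2n; field.
rewrite cos_pihalf => e; nra.
Qed.

(** The imaginary part suffices: by the mean value theorem [sin t >= t / 2], as [cos] stays above
    [1 / 2] up to [pi / 4]. *)
Lemma chord_ge t : 0 <= t <= pi / 4 -> t / 2 <= nm (1 - expi t).
Proof.
move=> /andP[t0 t4].
have : t / 2 <= sin t.
  have [->|tn0] := eqVneq t 0; first by rewrite sin0 mul0r.
  have tp : 0 < t by rewrite lt_neqAle eq_sym tn0.
  have [c] : exists2 c, c \in `]0, t[ & sin t - sin 0 = cos c * (t - 0).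
    apply: (@MVT R sin cos) => //.
    by apply: continuous_subspaceT => x; exact: continuous_sin.
  rewrite in_itv/= => /andP[c0 ct].
  rewrite sin0 !subr0 => ->; rewrite mulrC ler_wpM2r//.
  apply: le_trans cos_piquarter_ge _; rewrite leNgt ltr_cos ?in_itv/=.
  - by rewrite -leNgt; lra.
  - by have := pi_gt0 R; lra.
  - by have := pi_gt0 R; lra.
move=> /le_trans; apply.
rewrite /nm normc_def/= sub0r sqrrN.
apply: le_trans (ler_norm _) _; rewrite -sqrtr_sqr ler_wsqrtr// lerDr.
exact: sqr_ge0.
Qed.

Lemma nm_le_ReIm (z : R[i]) : nm z <= `|complex.Re z| + `|complex.Im z|.
Proof.
rewrite /nm normc_def/= -[X in _ <= X]ger0_norm ?addr_ge0// -sqrtr_sqr.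
rewrite ler_wsqrtr// sqrrD !real_normK ?num_real// -addrA lerD2l lerDr.
by rewrite mulrn_wge0// mulr_ge0.
Qed.

Lemma continuous_expi : continuous (@expi R : R -> R[i]^o).
Proof.
move=> t; apply/cvgrPdist_lt => e e0.
have [e' ee'] : exists e', e = e'%:C by exists (complex.Re e); rewrite RRe_real// gtr0_real.
move: e0; rewrite ee' ltcR => e0.
have e20 : 0 < e' / 2 by lra.
near=> u.
rewrite [X in X < _](nmE (expi t - expi u)) ltcR.
apply: le_lt_trans (nm_le_ReIm _) _ => /=.
have : `|cos t - cos u| < e' / 2.
  by near: u; move/cvgrPdist_lt : (@continuous_cos R t); apply.
have : `|sin t - sin u| < e' / 2.
  by near: u; move/cvgrPdist_lt : (@continuous_sin R t); apply.
by lra.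
Unshelve. all: by end_near. Qed.

Lemma near_expi t (e : R) : 0 < e -> \forall u \near t, nm (expi t - expi u) < e.
Proof.
move=> e0; move/cvgrPdist_lt : (@continuous_expi t) => /(_ e%:C).
rewrite ltcR => /(_ e0); apply: filterS => u.
by rewrite [X in X < _](nmE (expi t - expi u)) ltcR.
Qed.

End expi_theory.

Section unit_roots.
Variables (R : realType) (N : nat) (w : R[i]).
Hypothesis nm_w : nm w = 1.
Hypothesis wN : w ^+ N = 1.
Hypothesis w_prim : forall m, (0 < m < N)%N -> w ^+ m != 1.

Let w0 : w != 0.
Proof. by rewrite -nm_eq0 nm_w oner_eq0. Qed.

Let nmwz (m : int) : nm (w ^ m) = 1.
Proof.
by case: m => m; rewrite ?NegzE -?exprnN ?nmV -?exprnP ?nmX nm_w expr1n ?invr1.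
Qed.

Let conj_w (m : int) : ((w ^ m)^*)%C = w ^ (- m).
Proof.
have wm0 : w ^ m != 0 by rewrite expfz_neq0.
apply: (mulfI wm0); rewrite -nm_sqr nmwz expr1n -expfzDr// subrr expr0z.
by rewrite rmorph1.
Qed.

(** For [m != 0] this is a geometric series: [w ^ m - 1] is nonzero, and multiplying the sum by it
    gives [w ^ (m N) - 1 = 0]. *)
Lemma sum_unit_root (m : int) : (`|m| < N)%N ->
  \sum_(i < N) (w ^ m) ^+ i = if m == 0 then N%:R else 0.
Proof.
move=> mN; case: eqVneq => [->|m0].
  by rewrite expr0z; under eq_bigr do rewrite expr1n; rewrite sumr_const card_ord.
have wm1 : w ^ m - 1 != 0.
  rewrite subr_eq0; case: m mN m0 => m mN m0; first by apply: w_prim; lia.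
  rewrite NegzE -exprnN invr_eq1; apply: w_prim; lia.
apply: (mulfI wm1); rewrite mulr0 -subrX1 exprnP exprz_exp mulrC -exprz_exp.
by rewrite -exprnP wN exp1rz subrr.
Qed.

Variable Q : pred nat.

(** The unnormalised [k]-th Fourier coefficient of the indicator of [Q] on the [N]-th roots of
    unity. *)
Definition root_sum (k : int) : R[i] := \sum_(s < N | Q s) (w ^+ s) ^ k.

(** Expanding the squared modulus gives pairs [s], [t]; summing [i] over a full period keeps only
    [s = t], whatever the shift [j]. *)
Lemma parseval_roots (j : nat) :
  \sum_(i < N) nm (root_sum (i%:Z - j%:Z)) ^+ 2 = N%:R * \sum_(s < N | Q s) 1.
Proof.
apply: (@complexI R); rewrite raddf_sum/= rmorphM/= rmorph_nat raddf_sum/=.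
under eq_bigr => i _.
  rewrite nm_sqr /root_sum rmorph_sum/= big_distrlr/=.
  under eq_bigr => s _.
    under eq_bigr => t _.
      rewrite !exprnP !exprz_exp conj_w -expfzDr//.
      rewrite (_ : _ + _ = (s%:Z - t%:Z) * (- j%:Z) + (s%:Z - t%:Z) * i%:Z); last by ring.
      rewrite expfzDr// -(exprz_exp w (s%:Z - t%:Z) i%:Z) -exprnP.
      over.
    over.
  over.
rewrite exchange_big/=.
rewrite mulr_sumr; apply: eq_bigr => s Qs; rewrite exchange_big/=.
under eq_bigr => t _.
  rewrite -mulr_sumr sum_unit_root; last first.
    by have := ltn_ord s; have := ltn_ord t; lia.
  over.
rewrite (bigD1 s)//= subrr eqxx mul0r expr0z mul1r big1 ?addr0 ?mulr1//.
move=> t /andP[_ ts]; rewrite subr_eq0 eqz_nat ifN ?mulr0//.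
by rewrite eq_sym.
Qed.

End unit_roots.

Arguments root_sum {R}.

(** With [L] sample points per arc, a choice of arcs becomes a choice of whole blocks of sample
    points. *)
Lemma sum_blocks {V : nmodType} (M L : nat) (Q : pred nat) (F : nat -> V) :
  \sum_(s < M * L | Q (s %/ L)%N) F s =
  \sum_(p < M | Q p) \sum_(t < L) F (p * L + t)%N.
Proof.
have [->|L0] := posnP L.
  rewrite muln0 big_ord0; under eq_bigr do rewrite big_ord0.
  by rewrite sumr_const mul0rn.
rewrite -(big_mkord (fun s => Q (s %/ L)%N)) -(big_mkord Q (fun p => \sum_(t < L) F (p * L + t)%N)).
elim: M => [|M IHM]; first by rewrite mul0n !big_geq.
rewrite (big_cat_nat _ (n := M * L))//= ?leq_mul// IHM (big_cat_nat _ (n := M) (p := M.+1))//=.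
congr (_ + _); rewrite -{1}[(M * L)%N]add0n big_addn mulSn addnK.
rewrite big_mkcond/= big_mkord [RHS]big_mkcond/= big_nat1.
under eq_bigr => i _ do rewrite addnC divnMDl// divn_small ?addn0//.
by case: (Q M) => //; rewrite sumr_const mul0rn.
Qed.

(** Each chosen block is a geometric progression, which [1 - z] collapses to two terms of modulus
    one. The bound counts blocks whatever their length [L]; it is the source of the [O(M / k)]
    decay. *)
Lemma block_geometric_bound {R : realType} (M L : nat) (Q : pred nat) (z : R[i]) :
  nm z = 1 ->
  nm (\sum_(s < M * L | Q (s %/ L)%N) z ^+ s) * nm (1 - z) <= 2 * M%:R.
Proof.
move=> z1; rewrite -nmM (sum_blocks M L Q (fun s => z ^+ s)) mulr_suml.
apply: le_trans (ler_nm_sum _ _ _ _) _.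
apply: (@le_trans _ _ (\sum_(p < M | Q p) 2)).
  apply: ler_sum => p _; under eq_bigr do rewrite exprD.
  rewrite -mulr_sumr -mulrA nmM nmX z1 expr1n mul1r mulrC.
  have -> : (1 - z) * \sum_(t < L) z ^+ t = 1 - z ^+ L.
    by rewrite -[RHS]opprB subrX1 -mulNr opprB.
  by apply: le_trans (ler_nmB _ _) _; rewrite nmX z1 expr1n (nm_nat 1).
rewrite sumr_const -[leLHS]mulr_natr ler_wpM2l// ler_nat.
by rewrite -[X in (_ <= X)%N]card_ord max_card.
Qed.

(** * Arcs meeting a null set *)

Section arcs.
Variables (R : realType) (E : set R[i]).

Definition arc_end (M p : nat) : R := p%:R * (pi *+ 2 / M%:R).

(* The arcs are closed, so that the arcs not meeting E are compact and stay at
   positive distance from E. *)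
Definition arc_meets (M p : nat) : bool :=
  `[< exists2 t, arc_end M p <= t <= arc_end M p.+1 & E (expi t) >].

Definition meeting_fraction (M : nat) : R :=
  (\sum_(p < M | arc_meets M p) 1) / M%:R.

Hypothesis E_closed : closed E.
Hypothesis E_null : circle_measure E = 0%E.

Let P : set R := @expi R @^-1` E.

Let P_closed : closed P.
Proof. by apply: closed_comp => // x _; exact: continuous_expi. Qed.

Let U (m : nat) : set R := \bigcup_(t in P) ball t m.+1%:R^-1.

Let G (m : nat) : set R := U m `&` [set` `[0, pi *+ 2[ ].

Let mG m : measurable (G m).
Proof.
apply: measurableI; last exact: measurable_itv.
apply: measurable_realfun.open_measurable; apply: bigcup_open => t _; exact: ball_open.
Qed.

(** A point lying in every [U m] is adherent to [P], which is closed. *)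
Let G_cap : \bigcap_m G m = P `&` [set` `[0, pi *+ 2[ ].
Proof.
apply/seteqP; split=> [x Gx|x [Px x2] m _]; last first.
  by split => //; exists x => //; exact: ballxx.
split; last by have [] := Gx 0%N I.
suff : closure P x by rewrite -(closure_id P).1.
move=> B /nbhs_ballP[e /= e0 Be].
have [m me] : exists m : nat, m.+1%:R^-1 < e.
  by have [m /= _ me] := near_infty_natSinv_lt (PosNum e0); exists m; exact: (me m (leqnn m)).
have [[t Pt xt] _] := Gx m I.
exists t; split => //; apply: Be.
by apply: le_ball (ltW me) _ _; exact/ball_sym.
Qed.

(** Continuity from above makes some neighbourhood [G m] of the null set small in measure.
    Sufficiently short arcs that meet [E] lie inside [G m], so their total length is small as
    well. *)
Lemma meeting_fraction_small (e : R) : 0 < e ->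
  exists2 M : nat, (0 < M)%N & meeting_fraction M <= e.
Proof.
move=> e0.
have muG : @lebesgue_measure R (G n) @[n --> \oo] --> 0%E.
  have -> : 0%E = @lebesgue_measure R (\bigcap_m G m) by rewrite G_cap -E_null.
  apply: nonincreasing_cvg_mu => //.
  - apply: (@le_lt_trans _ _ (@lebesgue_measure R [set` `[0, pi *+ 2[ ])).
      by apply: le_measure; rewrite ?inE; [exact: mG|exact: measurable_itv|exact: subIsetr].
    by rewrite lebesgue_measure_itv/=; case: ifP => // _; rewrite -EFinB ltry.
  - rewrite G_cap; apply: measurableI; last exact: measurable_itv.
    exact: measurable_realfun.closed_measurable.
  - move=> n m nm; apply/subsetPset => x [[t Pt xt] x2]; split => //.
    exists t => //; apply: le_ball xt; rewrite lef_pV2 ?posrE//.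
    by rewrite ler_nat.
have [m muGm] : exists m, (@lebesgue_measure R (G m) < (pi *+ 2 * e)%:E)%E.
  have : \forall n \near \oo, (@lebesgue_measure R (G n) < (pi *+ 2 * e)%:E)%E.
    apply: (muG [set y | (y < (pi *+ 2 * e)%:E)%E]).
    apply: open_nbhs_nbhs; split; first exact: open_ereal_lt_ereal.
    by rewrite /= lte_fin mulr_gt0// pmulrn_lgt0// pi_gt0.
  by case=> m _ mP; exists m; apply: mP => /=.
(* Large enough for the arc length [2 pi / M] to be below the radius of the neighbourhood [U m]. *)
pose M := (Num.truncn (pi *+ 2 * m.+1%:R : R)).+1.
have M0 : (0 < M)%N by [].
have dM : pi *+ 2 / M%:R < m.+1%:R^-1 :> R.
  rewrite ltr_pdivrMr ?ltr0n// mulrC ltr_pdivlMr ?ltr0n//.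
  by have := truncnS_gt (pi *+ 2 * m.+1%:R : R).
set d := pi *+ 2 / M%:R in dM.
have d0 : 0 < d by rewrite divr_gt0 ?ltr0n// pmulrn_lgt0 // pi_gt0.
exists M => //.
(* Half-open arcs are disjoint and stay in [[0, 2 pi[], whereas [arc_meets] tests closed arcs. A
   point of [E] at the excluded right end is still within [d] of every point of the arc. *)
pose I (p : 'I_M) : set R := [set` `[arc_end M p, arc_end M p.+1[ ].
have arcS p : arc_end M p.+1 = arc_end M p + d by rewrite /arc_end -natr1 mulrDl mul1r.
have muI p : @lebesgue_measure R (I p) = d%:E.
  rewrite /I lebesgue_measure_itv/= arcS lte_fin ltrDl d0 -EFinB; congr (_%:E).
  by rewrite addrC addKr.
have le_arc p q : (p <= q)%N -> arc_end M p <= arc_end M q.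
  by move=> pq; rewrite /arc_end ler_wpM2r ?ler_nat// ltW.
have tI : trivIset setT I.
  apply/trivIsetP => p q _ _ pq; rewrite -subset0 => x [] /=.
  rewrite /I/= !in_itv/= => /andP[px xp] /andP[qx xq].
  move: pq; rewrite -val_eqE/= neq_ltn => /orP[] /le_arc h; lra.
have eqmu : @lebesgue_measure R (\big[setU/set0]_(p < M | arc_meets M p) I p) =
    (\sum_(p < M | arc_meets M p) d)%:E.
  rewrite measure_bigsetU_ord//; last by move=> p; exact: measurable_itv.
  by rewrite -sumEFin; apply: eq_bigr => p _; exact: muI.
have : (@lebesgue_measure R (\big[setU/set0]_(p < M | arc_meets M p) I p) <=
    @lebesgue_measure R (G m))%E.
  apply: le_measure; rewrite ?inE//.
    by apply: bigsetU_measurable => p _; exact: measurable_itv.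
    exact: mG.
  apply: (@big_ind (set R) (fun A => A `<=` G m) set0 setU) => [x []|A B AG BG x [/AG|/BG]//|p].
  move=> /asboolP[t]; rewrite arcS => /andP[pt tp] Et x; rewrite /I /=.
  rewrite in_itv/= arcS => /andP[px xp]; split => /=.
    exists t => //; rewrite /ball/=; apply: le_lt_trans dM.
    by rewrite ler_norml; lra.
  rewrite in_itv/=; apply/andP; split.
    by apply: le_trans px; rewrite /arc_end mulr_ge0// ltW.
  apply: lt_le_trans xp _; rewrite -arcS.
  apply: le_trans (le_arc _ M _) _; first exact: ltn_ord.
  by rewrite /arc_end mulrC divfK// pnatr_eq0.
move=> /le_lt_trans/(_ muGm); rewrite [X in (X < _)%E]eqmu lte_fin.
rewrite /meeting_fraction -(mulr1 d) -mulr_sumr => h.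
rewrite ler_pdivrMr ?ltr0n//.
have pi20 : 0 < pi *+ 2 :> R by rewrite pmulrn_lgt0// pi_gt0.
have M0' : 0 < M%:R :> R by rewrite ltr0n.
rewrite ltW// -(ltr_pM2l d0); apply: lt_le_trans h _.
by rewrite /d mulrCA divfK ?gt_eqF// mulrC.
Qed.

End arcs.

Arguments arc_end {R}.
Arguments arc_meets {R}.
Arguments meeting_fraction {R}.

(** * A slowly growing sequence adapted to the arcs *)

(** The terms are at most [k^(-3/2)], which is below the telescoping difference
    [2 / sqrt (k - 1) - 2 / sqrt k]; [1 < K] keeps [k - 1] positive. *)
Lemma sum_three_halves {R : realType} (v : nat -> R) (K n : nat) :
  (forall k, (0 < k)%N -> v k ^+ 2 <= k%:R) ->
  (1 < K)%N ->
  \sum_(K <= k < n) v k / k%:R ^+ 2 <= 2 / Num.sqrt (K.-1)%:R.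
Proof.
move=> vk K1.
apply: (@le_trans _ _ (\sum_(K <= k < n)
  (2 / Num.sqrt (k.-1)%:R - 2 / Num.sqrt (k.+1.-1)%:R))).
  rewrite big_nat_cond [leRHS]big_nat_cond.
  apply: ler_sum => -[|k]; first by rewrite leqNgt ltnW.
  rewrite andbT => /andP[Kk _] /=.
  have k0 : (0 < k)%N by rewrite -ltnS (leq_trans K1).
  set a : R := Num.sqrt k%:R; set b : R := Num.sqrt k.+1%:R.
  have a0 : 0 < a by rewrite sqrtr_gt0 ltr0n.
  have b0 : 0 < b by rewrite sqrtr_gt0 ltr0n.
  have a2 : a ^+ 2 = k%:R by rewrite sqr_sqrtr.
  have b2 : b ^+ 2 = k.+1%:R by rewrite sqr_sqrtr.
  have ab : b ^+ 2 = a ^+ 2 + 1 by rewrite a2 b2 -natr1.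
  have leab : a <= b by rewrite ler_wsqrtr// ler_nat.
  have vb : v k.+1 <= b.
    apply: le_trans (ler_norm _) _; rewrite -(ger0_norm (ltW b0)).
    by rewrite -ler_sqr ?nnegrE// !real_normK ?num_real// b2 vk.
  rewrite -b2; apply: (@le_trans _ _ (b / (b ^+ 2) ^+ 2)).
    by rewrite ler_wpM2r// invr_ge0 sqr_ge0.
  have -> : 2 / a - 2 / b = 2 / (a * b * (a + b)).
    have e1 : (b - a) * (b + a) = 1 by rewrite -subr_sqr; lra.
    rewrite -[2 in RHS]mulr1 -e1; field; apply/and3P; split; lra.
  have -> : b / (b ^+ 2) ^+ 2 = 2 / (2 * b ^+ 3) by field; lra.
  rewrite ler_pM2l// lef_pV2 ?posrE; last 2 first.
    by rewrite mulr_gt0// exprn_gt0.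
    by rewrite !mulr_gt0// addr_gt0.
  have -> : 2 * b ^+ 3 = b * b * (b + b) by ring.
  have a0' := ltW a0; have b0' := ltW b0.
  apply: ler_pM; rewrite ?mulr_ge0 ?addr_ge0//; first by apply: ler_pM.
  exact: lerD.
have [nK|Kn] := leqP n K; first by rewrite big_geq// divr_ge0 ?sqrtr_ge0.
pose f k : R := - (2 / Num.sqrt k.-1%:R).
rewrite (eq_bigr (fun k => f k.+1 - f k)); last first.
  by move=> k _; rewrite /f opprK addrC.
rewrite telescope_sumr; last exact: ltnW.
rewrite /f opprK addrC gerDl oppr_le0.
apply: divr_ge0; first by [].
exact: sqrtr_ge0.
Qed.

(* [u k] is one plus the number of thresholds [A 0, A 1, ...] passed before
   the first one exceeding [k]; the thresholds grow so fast that [u] stays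
   small compared with all the data attached to the partition into [M j] arcs. *)
Lemma slow_sequence {R : realType} (phi : nat -> R) :
  (forall e, 0 < e -> exists2 M : nat, (0 < M)%N & phi M <= e) ->
  exists u : nat -> nat,
  [/\ forall n, (0 < u n)%N,
      forall n, (0 < n)%N -> (u n ^ 8 <= n)%N,
      forall m, exists n0, forall n, (n0 <= n)%N -> (m <= u n)%N &
      forall e : R, 0 < e -> exists M K : nat, exists W : R,
      [/\ (0 < M)%N /\ (0 < K)%N, 0 <= W, phi M * W <= e,
          forall k, (k < K)%N -> (u k)%:R ^+ 4 <= W &
          forall n, M%:R ^+ 2 * (\sum_(K <= k < n) (u k)%:R ^+ 4 / k%:R ^+ 2) <= e]].
Proof.
move=> phi_small.
(* The exponent [5] beats by one power the weight [W = j.+1%:R ^+ 4] chosen below, leaving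
   [1 / (j + 1)]. *)
have /choice[M M_spec] : forall j : nat, exists M : nat, (0 < M)%N /\ phi M <= j.+1%:R ^- 5.
  by move=> j; have [|m m0 pm] := phi_small (j.+1%:R ^- 5); [rewrite invr_gt0 exprn_gt0|exists m].
(* The first summand yields [u k ^ 8 <= k], the second cancels [M j ^ 2] in the tail up to
   [2 / (j + 1)], and the last makes up for the [.-1] in [sum_three_halves]. *)
pose A j := ((j.+2) ^ 8 + M j ^ 4 * j.+1 ^ 2 + 1)%N.
have Abig k : exists j, (k < A j)%N.
  exists k; rewrite /A -addnA; apply: (@leq_trans (k.+2 ^ 8)); last exact: leq_addr.
  apply: (@leq_trans k.+2) => //.
  by rewrite -[X in (X <= _)%N]expn1; apply: leq_pexp2l.
pose h k := ex_minn (Abig k).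
have h_lt k : (k < A (h k))%N by rewrite /h; case: ex_minnP.
have h_le k j : (k < A j)%N -> (h k <= j)%N.
  by rewrite /h; case: ex_minnP => m _ mP; exact: mP.
have h8 k : (0 < k)%N -> ((h k).+1 ^ 8 <= k)%N.
  move=> k0; case e: (h k) => [|m]; first by rewrite exp1n.
  have : (A m <= k)%N by rewrite leqNgt; apply/negP => /h_le; rewrite e ltnn.
  by apply: leq_trans; rewrite /A -addnA leq_addr.
exists (fun k => (h k).+1); split => //.
  (* The thresholds need not be monotone, so their sum serves as a bound for all of them. *)
  move=> m; exists (\sum_(j < m) A j)%N => n mn; apply: leqW.
  rewrite leqNgt; apply/negP => hm.
  have := h_lt n; rewrite ltnNge => /negP; apply.
  by apply: leq_trans mn; rewrite (bigD1 (Ordinal hm))//= leq_addr.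
move=> e e0.
pose j := Num.truncn (2 / e).
have je : 2 / j.+1%:R <= e.
  rewrite ler_pdivrMr ?ltr0n// mulrC -ler_pdivrMr//.
  exact/ltW/truncnS_gt.
have [M0 phiM] := M_spec j.
exists (M j), (A j), (j.+1%:R ^+ 4); split.
- by split => //; rewrite /A addn1.
- by rewrite exprn_ge0.
- apply: (@le_trans _ _ (j.+1%:R ^- 5 * j.+1%:R ^+ 4)).
    by rewrite ler_wpM2r// exprn_ge0.
  have -> : j.+1%:R ^- 5 * j.+1%:R ^+ 4 = j.+1%:R^-1 :> R by field.
  apply: le_trans je; rewrite -[leLHS]mul1r ler_wpM2r ?invr_ge0//.
  by rewrite ler1n.
- move=> k kA; have hj := h_le _ _ kA.
  by rewrite lerXn2r ?nnegrE// ler_nat ltnS.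
move=> n.
have A1 : (1 < A j)%N by rewrite /A addn1 ltnS addn_gt0 expn_gt0.
apply: le_trans je.
apply: (@le_trans _ _ ((M j)%:R ^+ 2 * (2 / Num.sqrt (A j).-1%:R))).
  rewrite ler_wpM2l ?exprn_ge0//.
  apply: (sum_three_halves (fun k => (h k).+1%:R ^+ 4)) => // k k0.
  by rewrite -exprM -natrX ler_nat h8.
have A0 : 0 < Num.sqrt (A j).-1%:R :> R by rewrite sqrtr_gt0 ltr0n -ltnS prednK// ltnW.
rewrite mulrCA ler_wpM2l//.
rewrite ler_pdivrMr// mulrC ler_pdivlMr ?ltr0n//.
rewrite -[leLHS]ger0_norm ?mulr_ge0 ?exprn_ge0// -sqrtr_sqr ler_wsqrtr//.
rewrite exprMn -exprM -!natrX -natrM ler_nat /A addn1/=.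
exact: leq_addl.
Qed.

(** * Vanishing of the zeroth coefficient of a sequence with null support *)

(** The window [[-j, n - 1 - j]] lies in [[-(n - 1), n - 1]]; the right side counts [k = 0] twice,
    which nonnegativity allows. *)
Lemma sum_shift_le {R : numDomainType} (g : int -> R) (n j : nat) :
  (forall k, 0 <= g k) -> (j < n)%N ->
  \sum_(i < n) g (i%:Z - j%:Z) <= \sum_(k < n) (g k%:Z + g (- k%:Z)).
Proof.
move=> g0 jn; rewrite big_split/= -(big_mkord xpredT (fun i => g (i%:Z - j%:Z))).
rewrite (big_cat_nat _ (n := j)) ?(ltnW jn)//= addrC lerD//.
  rewrite -[X in \sum_(X <= _ < _) _]add0n big_addn big_mkord.
  rewrite (eq_bigr (fun k : 'I_(n - j) => g k%:Z)); last by move=> k _; congr (g _); lia.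
  rewrite -(big_mkord xpredT (fun k => g k%:Z)) -[X in _ <= X](big_mkord xpredT (fun k => g k%:Z)).
  by rewrite [leRHS](big_cat_nat _ (n := n - j)) ?leq_subr//= lerDl sumr_ge0.
rewrite big_nat_rev/= -(big_mkord xpredT (fun k => g (- k%:Z))).
rewrite [leRHS](big_cat_nat _ (n := j.+1))//= ler_wpDr ?sumr_ge0//.
rewrite [leRHS]big_nat_recl//= ler_wpDl//.
rewrite big_nat_cond [leRHS]big_nat_cond ler_sum// => i /andP[/andP[_ ij] _].
by rewrite le_eqVlt; apply/orP; left; apply/eqP; congr (g _); lia.
Qed.

Lemma absz_sub_lt (i j n : nat) : (i < n)%N -> (j < n)%N -> (`|i%:Z - j%:Z| < n)%N.
Proof. lia. Qed.

Section uniqueness.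
Variables (R : realType) (E : set R[i]) (u : nat -> nat) (b : int -> R[i]) (A : R).
Hypothesis u_gt0 : forall n, (0 < u n)%N.
Hypothesis u8 : forall n, (0 < n)%N -> (u n ^ 8 <= n)%N.
Hypothesis u_slow : forall e : R, 0 < e -> exists M K : nat, exists W : R,
  [/\ (0 < M)%N /\ (0 < K)%N, 0 <= W, meeting_fraction E M * W <= e,
      forall k, (k < K)%N -> (u k)%:R ^+ 4 <= W &
      forall n, M%:R ^+ 2 * (\sum_(K <= k < n) (u k)%:R ^+ 4 / k%:R ^+ 2) <= e].
Hypothesis bA : forall n, \sum_(k < n)
  (nm (b k%:Z) ^+ 2 + nm (b (- k%:Z)) ^+ 2) / (u k)%:R ^+ 4 <= A.

Let A0 : 0 <= A.
Proof. by apply: le_trans (bA 0); rewrite big_ord0. Qed.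

Let wgt (k : int) : R := (u `|k|%N)%:R ^+ 4.

Let wgt_gt0 k : 0 < wgt k.
Proof. by rewrite exprn_gt0// ltr0n. Qed.

Section one_scale.
Variables (M K l : nat) (W e tau : R).
Hypothesis M0 : (0 < M)%N.
Hypothesis K0 : (0 < K)%N.
Hypothesis l0 : (0 < l)%N.
Hypothesis W0 : 0 <= W.
Hypothesis fW : meeting_fraction E M * W <= e.
Hypothesis uW : forall k, (k < K)%N -> (u k)%:R ^+ 4 <= W.
Hypothesis tailM :
  forall n, M%:R ^+ 2 * (\sum_(K <= k < n) (u k)%:R ^+ 4 / k%:R ^+ 2) <= e.
Hypothesis tau0 : 0 < tau.

(* The factor 8 keeps the angles [2 pi k / N] with [k < n] in the range of
   [chord_ge], and makes these [k] distinct modulo [N]. *)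
Let n := (M * l)%N.
Let L := (8 * l)%N.
Let N := (M * L)%N.
Let theta : R := pi *+ 2 / N%:R.
Let w : R[i] := (expi theta)^-1.

Let L0 : (0 < L)%N. Proof. by rewrite muln_gt0. Qed.
Let n0 : (0 < n)%N. Proof. by rewrite muln_gt0 M0. Qed.
Let N0 : (0 < N)%N. Proof. by rewrite muln_gt0 M0. Qed.
Let N8n : N = (8 * n)%N. Proof. by rewrite /N /L /n mulnCA. Qed.
Let NR0 : 0 < N%:R :> R. Proof. by rewrite ltr0n. Qed.

Let nm_w : nm w = 1.
Proof. by rewrite nmV nm_expi invr1. Qed.

Let w_expi s : w ^+ s = (expi (theta * s%:R))^-1.
Proof. by rewrite expiM_nat exprVn. Qed.

Let wN : w ^+ N = 1.
Proof. by rewrite w_expi /theta divfK ?gt_eqF// expi_2pi invr1. Qed.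

Let pi20 : 0 < pi *+ 2 :> R.
Proof. by rewrite pmulrn_lgt0// pi_gt0. Qed.

Let theta0 : 0 < theta.
Proof. by rewrite divr_gt0. Qed.

Let w_prim m : (0 < m < N)%N -> w ^+ m != 1.
Proof.
move=> /andP[m0 mN]; rewrite w_expi invr_eq1 expi_neq1//.
rewrite mulr_gt0 ?ltr0n//= /theta mulrAC ltr_pdivrMr// ltr_pM2l//.
by rewrite ltr_nat.
Qed.

Let Q (s : nat) : bool := arc_meets E M (s %/ L).

Let c := root_sum N w Q.

Let count_Q : \sum_(s < N | Q s) 1 = N%:R * meeting_fraction E M :> R.
Proof.
rewrite (sum_blocks M L (arc_meets E M) (fun=> 1 : R)).
rewrite (eq_bigr (fun=> L%:R : R)); last by move=> p _; rewrite sumr_const card_ord.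
rewrite /meeting_fraction mulrCA mulr_suml; apply: eq_bigr => p _.
by rewrite mul1r /N natrM mulrAC divff ?mul1r// pnatr_eq0 -lt0n.
Qed.

(** As [N = 8 n], the angle [2 pi |k| / N] is at most [pi / 4], so the chord is at least half of it;
    [pi >= 2] concludes. *)
Let chord_w (k : int) : (`|k| < n)%N -> 2 * `|k|%N%:R / N%:R <= nm (1 - w ^ k).
Proof.
have nat_case (m : nat) : (m < n)%N -> 2 * m%:R / N%:R <= nm (1 - expi theta ^+ m).
  move=> mn; rewrite -expiM_nat.
  have tm : theta * m%:R = 2 * (pi * (m%:R / N%:R)).
    by rewrite /theta mulr2n; field; rewrite pnatr_eq0 -lt0n.
  have mN : m%:R / N%:R <= 8^-1 :> R.
    by rewrite ler_pdivrMr// ler_pdivlMl// -natrM ler_nat N8n leq_mul// ltnW.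
  have mN0 : 0 <= m%:R / N%:R :> R by rewrite divr_ge0.
  have pi2 := pi_ge2 R.
  apply: le_trans (chord_ge _ _ _); rewrite tm; first by rewrite -mulrA; nra.
  by apply/andP; split; nra.
have conjw (m : nat) : nm (1 - w ^+ m) = nm (1 - expi theta ^+ m).
  have e0 : expi theta ^+ m != 0 by rewrite -nm_eq0 nmX nm_expi expr1n oner_eq0.
  rewrite /w exprVn; have -> : 1 - (expi theta ^+ m)^-1 =
      - ((expi theta ^+ m)^-1 * (1 - expi theta ^+ m)).
    by rewrite mulrBr mulr1 mulVf// opprB.
  by rewrite nmN nmM nmV nmX nm_expi expr1n invr1 mul1r.
case: k => m mn; first by rewrite -exprnP conjw; exact: nat_case.
rewrite NegzE -exprnN /w exprVn invrK; apply: nat_case.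
by move: mn; rewrite NegzE; lia.
Qed.

Let c_tail (k : int) : (0 < `|k| < n)%N -> nm (c k) <= M%:R * N%:R / `|k|%N%:R.
Proof.
move=> /andP[k0 kn].
have wk1 : nm (w ^ k) = 1.
  by case: k {k0 kn} => m; rewrite ?NegzE -?exprnN ?nmV -?exprnP ?nmX nm_w expr1n ?invr1.
have := block_geometric_bound M L (arc_meets E M) (w ^ k) wk1.
have -> : \sum_(s < M * L | arc_meets E M (s %/ L)) (w ^ k) ^+ s = c k.
  by apply: eq_bigr => s _; rewrite !exprnP !exprz_exp mulrC.
move=> h; have kR : 0 < `|k|%N%:R :> R by rewrite ltr0n.
rewrite ler_pdivlMr//; have := chord_w _ kn; rewrite ler_pdivrMr// => ch.
have := ler_wpM2l (nm_ge0 (c k)) ch; have := ler_wpM2r (ltW NR0) h; lra.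
Qed.

(** The frequencies split at [K]. Below it the weight is at most [W], and Parseval with [fW] gives
    [N ^ 2 e]; from [K] on, [c_tail] and [tailM] give [N ^ 2 e] for each sign of [k]. Hence the
    factor [3]. *)
Let sum_c2 (j : nat) : (j < n)%N ->
  \sum_(i < n) wgt (i%:Z - j%:Z) * nm (c (i%:Z - j%:Z)) ^+ 2 <= N%:R ^+ 2 * (3 * e).
Proof.
move=> jn.
pose g (k : int) : R := if (K <= `|k|)%N then wgt k / `|k|%N%:R ^+ 2 else 0.
have g_ge0 k : 0 <= g k.
  by rewrite /g; case: ifP => // _; rewrite divr_ge0// ltW.
have sum_g : \sum_(i < n) M%:R ^+ 2 * g (i%:Z - j%:Z) <= 2 * e.
  rewrite -mulr_sumr.
  apply: (@le_trans _ _ (M%:R ^+ 2 * \sum_(k < n) (g k%:Z + g (- k%:Z)))).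
    by rewrite ler_wpM2l ?sqr_ge0//; exact: sum_shift_le.
  have -> : \sum_(k < n) (g k%:Z + g (- k%:Z)) =
      2 * \sum_(K <= k < n) (u k)%:R ^+ 4 / k%:R ^+ 2.
    rewrite big_geq_mkord mulr_sumr [RHS]big_mkcond/=; apply: eq_bigr => k _.
    rewrite /g /wgt abszN absz_nat; case: ifP => _; last by rewrite addr0.
    by rewrite mulrDl !mul1r.
  by rewrite mulrCA ler_wpM2l.
have sum_W : \sum_(i < n) W * nm (c (i%:Z - j%:Z)) ^+ 2 <= N%:R ^+ 2 * e.
  rewrite -mulr_sumr.
  have nN : (n <= N)%N by rewrite N8n leq_pmull.
  apply: (@le_trans _ _ (W * (N%:R * \sum_(s < N | Q s) 1))).
    rewrite ler_wpM2l// -(parseval_roots _ N w nm_w wN w_prim Q j).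
    rewrite -(big_mkord xpredT (fun i => nm (c (i%:Z - j%:Z)) ^+ 2)).
    rewrite -[leRHS](big_mkord xpredT (fun i => nm (root_sum N w Q (i%:Z - j%:Z)) ^+ 2)).
    rewrite [leRHS](big_cat_nat _ (n := n))//= lerDl sumr_ge0// => i _.
    exact: sqr_ge0.
  rewrite count_Q; move: fW; set phi := meeting_fraction E M => phiW.
  have -> : W * (N%:R * (N%:R * phi)) = N%:R ^+ 2 * (phi * W) by ring.
  by rewrite ler_wpM2l// sqr_ge0.
have -> : N%:R ^+ 2 * (3 * e) = N%:R ^+ 2 * e + N%:R ^+ 2 * (2 * e) by ring.
apply: le_trans (lerD sum_W (ler_wpM2l (sqr_ge0 _) sum_g)).
rewrite mulr_sumr -big_split/=; apply: ler_sum => i _.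
have kn : (`|i%:Z - j%:Z| < n)%N by exact: absz_sub_lt.
move: (i%:Z - j%:Z) kn => k kn; rewrite /g; case: leqP => kK.
  rewrite ler_wpDl ?(mulr_ge0 W0 (sqr_ge0 _))//.
  have k0 : (0 < `|k|)%N := leq_trans K0 kK.
  have := c_tail k; rewrite k0 kn => /(_ isT) ct.
  have -> : N%:R ^+ 2 * (M%:R ^+ 2 * (wgt k / `|k|%N%:R ^+ 2)) =
      wgt k * (M%:R * N%:R / `|k|%N%:R) ^+ 2.
    by field; rewrite pnatr_eq0 -lt0n.
  by rewrite ler_wpM2l ?(ltW (wgt_gt0 k))// ler_sqr ?nnegrE ?nm_ge0.
by rewrite !mulr0 addr0 ler_wpM2r ?sqr_ge0// uW.
Qed.

Let sum_b2 (j : nat) : (j < n)%N ->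
  \sum_(i < n) nm (b (i%:Z - j%:Z)) ^+ 2 / wgt (i%:Z - j%:Z) <= A.
Proof.
move=> jn; apply: le_trans (bA n).
apply: le_trans (sum_shift_le (fun k => nm (b k) ^+ 2 / wgt k) n j _ jn) _.
  by move=> k; rewrite divr_ge0 ?sqr_ge0// ltW.
by apply: ler_sum => k _; rewrite /wgt abszN absz_nat -mulrDl.
Qed.

(** Summing over [s] first turns the exponentials into the coefficients [c]. The weights [wgt] of
    [c] and [1 / wgt] of [b] cancel in each product, and [tau] balances the two square sums. *)
Let bad_part :
  nm (\sum_(s < N | Q s) \sum_(j < n) \sum_(i < n) (w ^+ s) ^ (i%:Z - j%:Z) * b (i%:Z - j%:Z))
  <= (n * N)%:R * ((tau * A + 3 * e / tau) / 2).
Proof.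
have -> : \sum_(s < N | Q s) \sum_(j < n) \sum_(i < n)
      (w ^+ s) ^ (i%:Z - j%:Z) * b (i%:Z - j%:Z) =
    \sum_(j < n) \sum_(i < n) c (i%:Z - j%:Z) * b (i%:Z - j%:Z).
  rewrite exchange_big/=; apply: eq_bigr => j _.
  rewrite exchange_big/=; apply: eq_bigr => i _.
  by rewrite -mulr_suml.
apply: le_trans (ler_nm_sum _ _ _ _) _.
rewrite natrM -mulrA.
have -> : n%:R * (N%:R * ((tau * A + 3 * e / tau) / 2)) =
    \sum_(j < n) (N%:R * ((tau * A + 3 * e / tau) / 2)).
  by rewrite sumr_const card_ord mulr_natl.
apply: ler_sum => j _.
apply: le_trans (ler_nm_sum _ _ _ _) _.
have -> : N%:R * ((tau * A + 3 * e / tau) / 2) =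
    N%:R * tau / 2 * A + (2 * N%:R * tau)^-1 * (N%:R ^+ 2 * (3 * e)).
  by field; rewrite !gt_eqF.
(* AM-GM on each term, with weight [N tau / wgt]. *)
have h1 : 0 <= N%:R * tau / 2 by rewrite divr_ge0// mulr_ge0// ltW.
have h2 : 0 <= (2 * N%:R * tau)^-1 by rewrite invr_ge0 !mulr_ge0// ltW.
apply: le_trans (lerD (ler_wpM2l h1 (sum_b2 _ (ltn_ord j)))
                      (ler_wpM2l h2 (sum_c2 _ (ltn_ord j)))).
rewrite !mulr_sumr -big_split/=; apply: ler_sum => i _.
move: (i%:Z - j%:Z) => k; rewrite nmM.
set x := nm (c k); set y := nm (b k); have := wgt_gt0 k; set v := wgt k => v0.
rewrite -subr_ge0.
have -> : N%:R * tau / 2 * (y ^+ 2 / v) + (2 * N%:R * tau)^-1 * (v * x ^+ 2) - x * y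
    = (N%:R * tau * y - v * x) ^+ 2 / (2 * N%:R * tau * v).
  by field; rewrite !gt_eqF.
by rewrite divr_ge0 ?sqr_ge0// !mulr_ge0// ltW.
Qed.

(** Summation over all [N] roots annihilates each frequency [i - j != 0], as [|i - j| < n <= N]; the
    [n] diagonal terms remain. *)
Let total :
  \sum_(s < N) \sum_(j < n) \sum_(i < n) (w ^+ s) ^ (i%:Z - j%:Z) * b (i%:Z - j%:Z)
  = (n * N)%:R * b 0.
Proof.
rewrite exchange_big/=.
have -> : (n * N)%:R * b 0 = \sum_(j < n) N%:R * b 0.
  by rewrite sumr_const card_ord natrM -mulrA mulr_natl.
apply: eq_bigr => j _; rewrite exchange_big/=.
rewrite (bigD1 j)//= [X in _ + X]big1 ?addr0; last first.
  move=> i ij; rewrite -mulr_suml.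
  rewrite (eq_bigr (fun s : 'I_N => (w ^ (i%:Z - j%:Z)) ^+ s)); last first.
    by move=> s _; rewrite !exprnP !exprz_exp mulrC.
  rewrite (sum_unit_root _ N w nm_w wN w_prim); last first.
    by rewrite (leq_trans (absz_sub_lt _ _ _ (ltn_ord i) (ltn_ord j)))// N8n leq_pmull.
  by rewrite subr_eq0 eqz_nat ifN ?mul0r.
rewrite subrr -mulr_suml; congr (_ * _).
by under eq_bigr do rewrite expr0z; rewrite sumr_const card_ord.
Qed.

(** [total] splits into the sample points on arcs avoiding [E], at most [N] of them contributing at
    most [D] each, and the others, treated by [bad_part]. Dividing by [n N] leaves [D / n] for the
    former. *)
Lemma one_scale_bound (D : R) : 0 <= D ->
  (forall p t, (p < M)%N -> ~~ arc_meets E M p ->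
     arc_end M p <= t <= arc_end M p.+1 ->
     nm (\sum_(j < n) \sum_(i < n) (expi t)^-1 ^ (i%:Z - j%:Z) * b (i%:Z - j%:Z)) <= D) ->
  nm (b 0) <= D / n%:R + (tau * A + 3 * e / tau) / 2.
Proof.
move=> D0 hD.
have nNR : 0 < (n * N)%:R :> R by rewrite ltr0n muln_gt0 n0.
rewrite -(ler_pM2l nNR) -{1}(nm_nat (n * N)) -nmM -total mulrDr.
rewrite (bigID (fun s : 'I_N => Q s))/= addrC.
apply: le_trans (ler_nmD _ _) _; apply: lerD bad_part.
have -> : (n * N)%:R * (D / n%:R) = \sum_(s < N) D.
  by rewrite sumr_const card_ord -mulr_natl natrM; field; rewrite pnatr_eq0 -lt0n.
apply: le_trans (ler_nm_sum _ _ _ _) _.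
rewrite big_mkcond/=; apply: ler_sum => s _; case: ifP => // Qs.
rewrite w_expi; apply: (hD (s %/ L)%N) => //.
  by rewrite ltn_divLR.
(* In units of the arc length the angle of sample [s] is [s / L], which lies between [s %/ L] and
   its successor. *)
have e1 : theta * s%:R = pi *+ 2 / M%:R * (s%:R / L%:R).
  by rewrite /theta /N natrM; field; rewrite !pnatr_eq0 -!lt0n L0.
have d0 : 0 <= pi *+ 2 / M%:R :> R by rewrite divr_ge0// ltW.
rewrite e1 /arc_end ![_ %:R * (_ / M%:R)]mulrC.
have LR : 0 < L%:R :> R by rewrite ltr0n.
apply/andP; split; apply: ler_wpM2l => //.
  by rewrite ler_pdivlMr// -natrM ler_nat leq_divM.
by rewrite ler_pdivrMr// -natrM ler_nat ltnW// ltn_ceil.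
Qed.

End one_scale.

(** [M] is fixed first, to make the arcs meeting [E] contribute little. [D] may depend on [M], but
    [u] grows so slowly that [D u / n] vanishes as [n = M l] grows. *)
Lemma null_support_coef0 :
  (forall M, (0 < M)%N -> exists D : R, 0 <= D /\
     forall p t n, (p < M)%N -> ~~ arc_meets E M p ->
     arc_end M p <= t <= arc_end M p.+1 ->
     nm (\sum_(j < n.+1) \sum_(i < n.+1) (expi t)^-1 ^ (i%:Z - j%:Z) * b (i%:Z - j%:Z))
     <= D * (u n.+2)%:R) ->
  b 0 = 0.
Proof.
move=> hD; apply/eqP; rewrite -nm_eq0 eq_le nm_ge0 andbT.
apply/ler_addgt0Pl => e e0; rewrite addr0.
(* This [tau] makes [tau * A <= e / 2], with [A + 1] because [A] may be [0]. The value [e * tau / 6]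
   given to [u_slow] then turns the other error term into [e / 2]. *)
pose tau := e / (2 * (A + 1)).
have A1 : 0 < A + 1 by rewrite ltr_wpDl.
have tau0 : 0 < tau by rewrite divr_gt0// mulr_gt0.
have e1 : 0 < e * tau / 6 by rewrite divr_gt0// mulr_gt0.
have [M [K [W [[M0 K0] W0 fW uW tailM]]]] := u_slow _ e1.
have [D [D0 hDM]] := hD M M0.
(* The closing comparison asks for [8 * D ^+ 2 <= n%:R * e ^+ 2], which the constant [12] covers. *)
have [l l0 ln] : exists2 l, (0 < l)%N & 12 * D ^+ 2 / e ^+ 2 <= l%:R.
  by exists (Num.truncn (12 * D ^+ 2 / e ^+ 2)).+1 => //; exact/ltW/truncnS_gt.
pose n := (M * l)%N.
have n0 : (0 < n)%N by rewrite muln_gt0 M0.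
have nl : (l <= n)%N by rewrite leq_pmull.
(* [hDM] at [n.-1] concerns sums of [n] terms and the value [u n.+1]. *)
have Du0 : 0 <= D * (u n.+1)%:R by rewrite mulr_ge0.
have := one_scale_bound M K l W _ tau M0 K0 l0 W0 fW uW tailM tau0 _ Du0.
rewrite -/n => /(_ _) h; apply: le_trans (h _) _.
  move=> p t pM nE pt.
  have := hDM p t n.-1 pM nE pt; by rewrite prednK.
have -> : 3 * (e * tau / 6) / tau = e / 2 by field; rewrite gt_eqF.
have tA : tau * A <= e / 2.
  have -> : tau * A = e / 2 * (A / (A + 1)) by rewrite /tau; field; rewrite gt_eqF.
  rewrite -[leRHS]mulr1 ler_wpM2l ?divr_ge0 ?ltW// ltr_pdivrMr// mul1r.
  by rewrite ltrDl.
suff : D * (u n.+1)%:R / n%:R <= e / 2 by lra.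
have nR : 0 < n%:R :> R by rewrite ltr0n.
rewrite ler_pdivrMr//.
have u2 : (u n.+1)%:R ^+ 2 <= n%:R *+ 2 :> R.
  have u2 : (u n.+1 ^ 2 <= n.+1)%N.
    exact: leq_trans (leq_pexp2l (u_gt0 _) (isT : 2 <= 8)%N) (u8 _ (ltn0Sn n)).
  rewrite -natrX mulr2n -natrD ler_nat (leq_trans u2)//.
  by rewrite -add1n leq_add2r.
have nD : 12 * D ^+ 2 <= n%:R * e ^+ 2.
  rewrite -ler_pdivrMr ?exprn_gt0//; apply: le_trans ln _.
  by rewrite ler_nat.
have en0 : 0 <= e / 2 * n%:R by rewrite mulr_ge0 ?divr_ge0// ltW.
rewrite -ler_sqr ?nnegrE//.
rewrite exprMn; apply: (@le_trans _ _ (D ^+ 2 * (n%:R *+ 2))).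
  by rewrite ler_wpM2l// sqr_ge0.
have -> : (e / 2 * n%:R) ^+ 2 = n%:R * (n%:R * e ^+ 2) / 4 by field.
rewrite ler_pdivlMr//.
apply: le_trans (ler_wpM2l (ltW nR) nD).
rewrite mulr2n; have := mulr_ge0 (ltW nR) (sqr_ge0 D); lra.
Qed.

End uniqueness.

(** * Contractions with spectrum in a null set *)

Section bounded_operators.
Variables (R : realType) (H : hilbertType R).
Implicit Types T S : H -> H.

Lemma bounded_opP T : bounded_op T ->
  linear T /\ exists2 M : R, 0 <= M & forall x, nm (T x) <= M * nm x.
Proof.
move=> [linT [M TM]]; split => //; exists `|M| => // x.
have := TM x; rewrite !nmE -rmorphM lecR => /le_trans; apply.
by rewrite ler_wpM2r ?nm_ge0// ler_norm.
Qed.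

Lemma nm_le_opnorm T x : bounded_op T -> nm (T x) <= opnorm T * nm x.
Proof.
move=> /bounded_opP[linT [M M0 TM]].
have [->|x0] := eqVneq x 0; first by rewrite (lin0 linT) !nm0 mulr0.
have nx0 : 0 < nm x by rewrite lt_neqAle eq_sym nm_eq0 x0 nm_ge0.
pose y := (nm x)^-1%:C *: x.
have yE : nm y = 1 by rewrite /y nmZ nm_real gtr0_norm ?invr_gt0// mulVf ?gt_eqF.
have -> : nm (T x) = nm (T y) * nm x.
  by rewrite /y (lin_scale linT) nmZ nm_real gtr0_norm ?invr_gt0// mulrAC mulVf ?mul1r ?gt_eqF.
rewrite ler_wpM2r ?nm_ge0//; apply: ub_le_sup; last first.
  by exists y => //=; rewrite nmE yE.
exists M => _ [z /= z1 <-]; apply: le_trans (TM z) _.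
by rewrite -[leRHS]mulr1 ler_wpM2l//; move: z1; rewrite nmE -[1]/(1%:C) lecR.
Qed.

Lemma opnorm_ge0 T : bounded_op T -> 0 <= opnorm T.
Proof.
move=> /bounded_opP[linT [M M0 TM]].
apply: (@le_trans _ _ (nm (T 0))); first exact: nm_ge0.
apply: ub_le_sup; last by exists 0 => //=; rewrite normr0.
exists M => _ [z /= z1 <-]; apply: le_trans (TM z) _.
by rewrite -[leRHS]mulr1 ler_wpM2l//; move: z1; rewrite nmE -[1]/(1%:C) lecR.
Qed.

Lemma bounded_op_iter T n : bounded_op T -> bounded_op (iter n T).
Proof.
move=> [linT [M TM]]; split.
  by elim: n => [//|n IHn] a x y /=; rewrite IHn linT.
have [_ [K K0 TK]] := bounded_opP _ (conj linT (ex_intro _ M TM)).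
exists (K ^+ n) => x; rewrite !nmE -rmorphM lecR.
elim: n => [|n IHn] /=; first by rewrite expr0 mul1r.
by apply: le_trans (TK _) _; rewrite exprS -mulrA ler_wpM2l.
Qed.

Lemma resolvent_below T l : bounded_op T -> ~ spectrum T l ->
  exists2 rho : R, 0 < rho & forall y, nm y <= rho * nm (T y - l *: y).
Proof.
move=> Tb /contrapT[S [Sb TS _]].
have [_ [M M0 SM]] := bounded_opP _ Sb.
(* The added [1] makes the constant strictly positive, so that it can be inverted. *)
exists (M + 1) => [|y]; first by rewrite ltr_wpDl.
rewrite -{1}(TS y); apply: le_trans (SM _) _.
by rewrite ler_wpM2r ?nm_ge0// lerDl.
Qed.

(** A bound at one point persists nearby with twice the constant, and compactness of [[a, b]] lets
    one constant serve the whole arc. *)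
Lemma resolvent_below_arc T (a b : R) (E : set R[i]) :
  bounded_op T -> spectrum T `<=` E ->
  (forall t, a <= t <= b -> ~ E (expi t)) ->
  \forall rho \near +oo, forall t, a <= t <= b ->
    forall y, nm y <= rho * nm (T y - expi t *: y).
Proof.
move=> Tb TE abE.
have /compact_near_coveringP cov : compact `[a, b] by exact: segment_compact.
suff : \forall rho \near +oo,
    `[a, b]%classic `<=` (fun t => forall y, nm y <= rho * nm (T y - expi t *: y)).
  by apply: filterS => rho h t tab; apply: h; rewrite /= in_itv.
apply: cov => t; rewrite /= in_itv/= => tab.
have [rho rho0 below] := resolvent_below T (expi t) Tb (fun st => abE t tab (TE _ st)).
near=> t' r => y.
(* At this distance the perturbation costs at most half of [nm y], which is absorbed on the left and
   doubles the constant. *)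
have tt' : nm (expi t - expi t') < (2 * rho)^-1.
  by near: t'; apply: near_expi; rewrite invr_gt0 mulr_gt0.
have r2 : 2 * rho <= r by near: r; apply: nbhs_pinfty_ge; rewrite num_real.
have := below y.
have -> : T y - expi t *: y = T y - expi t' *: y - (expi t - expi t') *: y.
  by rewrite scalerBl opprB addrA subrK.
have := ler_nmB (T y - expi t' *: y) ((expi t - expi t') *: y).
rewrite nmZ; set p := nm (T y - expi t' *: y) => qle yq.
have half : nm y <= rho * p + 2^-1 * nm y.
  apply: le_trans yq _; apply: le_trans (ler_wpM2l (ltW rho0) qle) _.
  rewrite mulrDr lerD2l mulrA ler_wpM2r ?nm_ge0//.
  by rewrite mulrC -ler_pdivlMr// -invfM mulrC ltW// mulrC.
have p0 : 0 <= p by exact: nm_ge0.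
apply: le_trans (ler_wpM2r p0 r2); lra.
Unshelve. all: by end_near. Qed.

End bounded_operators.

(* [(t' - t) / t'^2 <= 1 / t - 1 / t'] telescopes. *)
Lemma sum_increments_bound {R : realFieldType} (t v : nat -> R) (C : R) n :
  0 < t 0%N -> {homo t : i j / (i <= j)%N >-> i <= j} ->
  (forall k, 0 < v k) -> (forall k, t k <= C * v k ^+ 2 * t 0%N) ->
  \sum_(k < n) (t k.+1 - t k) / v k.+1 ^+ 4 <= C ^+ 2 * t 0%N.
Proof.
move=> t0 tle v0 tv.
have tk k : 0 < t k by apply: lt_le_trans t0 (tle _ _ _).
apply: (@le_trans _ _ (\sum_(k < n) (C * t 0%N) ^+ 2 * ((t k)^-1 - (t k.+1)^-1))).
  apply: ler_sum => k _.
  have d0 : 0 <= t k.+1 - t k by rewrite subr_ge0 tle.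
  have -> : (t k)^-1 - (t k.+1)^-1 = (t k.+1 - t k) * ((t k)^-1 * (t k.+1)^-1).
    by field; rewrite !gt_eqF.
  rewrite mulrCA ler_wpM2l//.
  rewrite -invfM ler_pdivlMr ?mulr_gt0// mulrC ler_pdivrMr ?exprn_gt0//.
  apply: (@le_trans _ _ (t k.+1 ^+ 2)).
    by rewrite expr2 ler_wpM2r ?tle// ltW.
  have -> : (C * t 0%N) ^+ 2 * v k.+1 ^+ 4 = (C * v k.+1 ^+ 2 * t 0%N) ^+ 2 by ring.
  have t1 := ltW (tk k.+1).
  by rewrite ler_sqr ?nnegrE// (le_trans t1).
rewrite -mulr_sumr -(big_mkord xpredT (fun k => (t k)^-1 - (t k.+1)^-1)).
rewrite (eq_bigr (fun k => - (t k.+1)^-1 - - (t k)^-1)); last first.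
  by move=> k _; rewrite opprK addrC.
rewrite telescope_sumr// opprK addrC mulrBr.
have -> : (C * t 0%N) ^+ 2 * (t 0%N)^-1 = C ^+ 2 * t 0%N by field; rewrite gt_eqF.
by rewrite gerBl mulr_ge0 ?sqr_ge0// invr_ge0 ltW.
Qed.

(** An isometry preserves inner products by [defect_eq0], so its inverse is an adjoint. *)
Lemma unitary_of_isometry {R : realType} (H : hilbertType R) (T S : H -> H) :
  linear T -> (forall x, nm (T x) = nm x) -> is_inverse T S -> unitary T.
Proof.
move=> linT isoT [Sb TS ST].
have innerT x y : inner (T x) (T y) = inner x y.
  by apply/eqP; rewrite eq_sym -subr_eq0; apply/eqP; exact: defect_eq0.
have innerI a b : (forall x, inner x a = inner x b) -> a = b.
  move=> ab; apply/eqP; rewrite -subr_eq0 -normr_eq0 -sqrf_eq0 -innerE.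
  by rewrite linearBr/= ab subrr.
(* [S] witnesses that an adjoint exists, so [adjoint T] is not the default value. *)
have [_ adjT] : is_adjoint T (adjoint T).
  by apply: xgetPex; exists S; split=> // x y; rewrite -{1}(ST y) innerT.
have adjK : cancel T (adjoint T).
  by move=> y; apply: innerI => x; rewrite -adjT innerT.
by split=> // y; rewrite -{1}(ST y) adjK ST.
Qed.

(** * The two-sided orbit of a vector and its defect coefficients *)

Section contraction_orbit.
Variables (R : realType) (H : hilbertType R) (T S : H -> H).
Hypothesis linT : linear T.
Hypothesis contrT : forall x, nm (T x) <= nm x.
Hypothesis ST : cancel S T.

(** [Negz m] stands for [-(m + 1)], hence the [m.+1] iterations. *)
Definition orbit (x : H) (k : int) : H :=
  match k with Posz m => iter m T x | Negz m => iter m.+1 S x end.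

Lemma orbitN x m : orbit x (- m%:Z) = iter m S x.
Proof. by case: m. Qed.

Lemma orbitS x k : T (orbit x k) = orbit x (k + 1).
Proof.
case: k => m; first by rewrite -PoszD addn1.
by rewrite (_ : Negz m + 1 = - m%:Z) ?orbitN /= ?ST//; lia.
Qed.

Lemma nm_orbit_le x k m : nm (orbit x (k + m%:Z)) <= nm (orbit x k).
Proof.
elim: m => [|m IHm]; first by rewrite addr0.
by rewrite -addn1 PoszD addrA -orbitS; exact: le_trans (contrT _) IHm.
Qed.

Variables (x : H) (v : nat -> R) (C : R).
Hypothesis v1 : forall n, 1 <= v n.
Hypothesis C0 : 0 <= C.
Hypothesis Sv : forall n, nm (iter n S x) <= C * v n * nm x.

Let q := nm x ^+ 2 - nm (T x) ^+ 2.
Hypothesis q0 : 0 < q.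

Let x0 : 0 < nm x.
Proof.
rewrite lt_neqAle nm_ge0 andbT eq_sym; apply/eqP => nx0; move: q0.
by rewrite /q nx0 expr0n sub0r oppr_gt0 ltNge sqr_ge0.
Qed.

Let b (k : int) : R[i] := defect T (orbit x k) x.

Let b_le k : nm (b k) ^+ 2 <=
  (nm (orbit x k) ^+ 2 - nm (orbit x (k + 1)) ^+ 2) * q.
Proof. by rewrite -orbitS; exact: defect_CauchySchwarz. Qed.

(** For [k >= 0] the bounds [b_le] telescope to [nm x ^+ 2 * q], the weights being at least [1]. The
    second sum repeats the index [0], which costs the same amount again; its other terms are
    increments of [|S^k x|^2], handled by [sum_increments_bound]. *)
Lemma sum_defect_bound n : \sum_(k < n)
  (nm (b k%:Z) ^+ 2 + nm (b (- k%:Z)) ^+ 2) / v k ^+ 4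
  <= (2 + (C ^+ 2) ^+ 2) * nm x ^+ 2 * q.
Proof.
have v4 k : 1 <= v k ^+ 4 by rewrite exprn_ege1.
have div_le k (z : R) : 0 <= z -> z / v k ^+ 4 <= z.
  by move=> z0; rewrite ler_pdivrMr ?(lt_le_trans ltr01)// ler_peMr.
under eq_bigr do rewrite mulrDl; rewrite big_split/=.
have pos : \sum_(k < n) nm (b k%:Z) ^+ 2 / v k ^+ 4 <= nm x ^+ 2 * q.
  pose s k := - nm (orbit x k%:Z) ^+ 2.
  apply: (@le_trans _ _ (\sum_(k < n) (s k.+1 - s k) * q)).
    apply: ler_sum => k _; apply: le_trans (div_le _ _ (sqr_ge0 _)) _.
    by apply: le_trans (b_le _) _; rewrite /s opprK addrC -PoszD addn1.
  rewrite -mulr_suml ler_wpM2r ?(ltW q0)//.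
  rewrite -(big_mkord xpredT (fun k => s k.+1 - s k)) telescope_sumr//.
  by rewrite /s opprK addrC gerBl sqr_ge0.
have neg : \sum_(k < n) nm (b (- k%:Z)) ^+ 2 / v k ^+ 4
    <= nm x ^+ 2 * q + (C ^+ 2) ^+ 2 * nm x ^+ 2 * q.
  case: n {pos} => [|n].
    have qx : 0 <= nm x ^+ 2 * q := mulr_ge0 (sqr_ge0 _) (ltW q0).
    by rewrite big_ord0 addr_ge0// -mulrA (mulr_ge0 (sqr_ge0 _)).
  rewrite big_ord_recl/= lerD//.
    apply: le_trans (div_le _ _ (sqr_ge0 _)) _.
    apply: le_trans (b_le _) _; rewrite ler_wpM2r ?(ltW q0)//=.
    by rewrite gerBl sqr_ge0.
  pose t k := nm (orbit x (- k%:Z)) ^+ 2.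
  apply: (@le_trans _ _ ((\sum_(k < n) (t k.+1 - t k) / v k.+1 ^+ 4) * q)).
    rewrite mulr_suml; apply: ler_sum => k _.
    rewrite [leRHS]mulrAC ler_wpM2r ?invr_ge0 ?(le_trans ler01)//.
    apply: le_trans (b_le _) _; rewrite /bump /= add1n /t.
    have -> : - k.+1%:Z + 1 = - k%:Z by lia.
    by [].
  rewrite ler_wpM2r ?(ltW q0)//.
  apply: (sum_increments_bound t v (C ^+ 2)).
  - by rewrite exprn_gt0.
  - move=> i j ij; rewrite /t ler_sqr ?nnegrE ?nm_ge0//.
    have := nm_orbit_le x (- j%:Z) (j - i).
    have -> : - j%:Z + (j - i)%N%:Z = - i%:Z by lia.
    by [].
  - by move=> k; apply: lt_le_trans (v1 k).
  - move=> k; rewrite /t /= orbitN -!exprMn ler_sqr ?nnegrE ?nm_ge0//.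
    by rewrite !mulr_ge0 ?nm_ge0// (le_trans _ (v1 k)).
by apply: le_trans (lerD pos neg) _; lra.
Qed.

(** By linearity the sum is [defect T V x], with [V] the Fejer sum of the orbit itself.
    [fejer_bound] at [z = lam^-1] controls [V], and Cauchy-Schwarz passes to the form. *)
Lemma fejer_defect_bound (rho : R) (lam : R[i]) n : 0 <= rho -> nm lam = 1 ->
  (forall y, nm y <= rho * nm (T y - lam *: y)) ->
  nm (\sum_(j < n.+1) \sum_(i < n.+1) lam^-1 ^ (i%:Z - j%:Z) * b (i%:Z - j%:Z))
  <= rho ^+ 2 * ((C + 3) * nm x) * Num.sqrt q * v n.+2.
Proof.
move=> rho0 lam1 below.
set V := \sum_(j < n.+1) \sum_(i < n.+1) lam^-1 ^ (i%:Z - j%:Z) *: orbit x (i%:Z - j%:Z).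
have -> : \sum_(j < n.+1) \sum_(i < n.+1) lam^-1 ^ (i%:Z - j%:Z) * b (i%:Z - j%:Z)
    = defect T V x.
  rewrite /V; under [X in defect _ X _]eq_bigr do rewrite -[\sum_(i < n.+1) _]scale1r.
  rewrite defect_sum//; apply: eq_bigr => j _; rewrite mul1r.
  by rewrite defect_sum.
have Vle : nm V <= rho ^+ 2 * ((C + 3) * nm x) * v n.+2.
  have lamV1 : nm lam^-1 = 1 by rewrite nmV lam1 invr1.
  have := fejer_bound R H T linT (orbit x) (orbitS x) lam^-1 rho lamV1 rho0 _ n.
  rewrite invrK => /(_ below) /le_trans; apply.
  rewrite -mulrA ler_wpM2l ?sqr_ge0//.
  have p1 : nm (orbit x 1) <= nm x by have := nm_orbit_le x 0 1.
  have p2 : nm (orbit x n.+2) <= nm x by have := nm_orbit_le x 0 n.+2; rewrite add0r.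
  (* Norms grow towards negative indices, so passing from [- n] to [- n.+2] brings in [v n.+2]
     without any monotonicity of [v]. *)
  have pn : nm (orbit x (- n%:Z)) <= C * v n.+2 * nm x.
    apply: le_trans (Sv n.+2); rewrite -orbitN.
    have := nm_orbit_le x (- n.+2%:Z) 2.
    have -> : - n.+2%:Z + 2%N%:Z = - n%:Z by lia.
    by [].
  have := v1 n.+2; have := nm_ge0 x; nra.
have Vq : nm (defect T V x) <= nm V * Num.sqrt q.
  have sq0 : 0 <= Num.sqrt q by exact: sqrtr_ge0.
  rewrite -ler_sqr ?nnegrE ?mulr_ge0 ?nm_ge0//.
  rewrite exprMn sqr_sqrtr ?(ltW q0)//.
  apply: le_trans (defect_CauchySchwarz _ _ _ _ _ _ _ _) _ => //.
  by rewrite ler_wpM2r ?(ltW q0)// gerBl sqr_ge0.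
by apply: le_trans Vq _; rewrite [leRHS]mulrAC ler_wpM2r// sqrtr_ge0.
Qed.

End contraction_orbit.

Theorem theorem1p5 (R : realType) (E : set R[i])
    (E_circle : E `<=` @unit_circle R)
    (E_closed : closed E)
    (E_null : circle_measure E = 0%E) :
  exists u : nat -> R,
    [/\ forall n : nat, (0 < n)%N -> 0 < u n,
        u n @[n --> \oo] --> +oo &
        forall (H : hilbertType R) (T : H -> H),
          bounded_op T ->
          opnorm T <= 1 ->
          spectrum T `<=` E ->
          (fun n : nat => opnorm (iter n (inverse_op T))) =O_\oo u ->
          finite_dimensional (range (fun x : H => x - adjoint T (T x))) ->
          unitary T].
Proof.
have [u [u_gt0 u8 u_infty u_slow]] :=
  slow_sequence (meeting_fraction E) (meeting_fraction_small R E E_closed E_null).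
exists (fun n => (u n)%:R); split.
- by move=> n _; rewrite ltr0n.
- apply/cvgryPge => A; have [n0 un0] := u_infty (Num.truncn A).+1.
  exists n0 => // n /= nn0; apply: le_trans (ltW (truncnS_gt A)) _.
  by rewrite ler_nat un0.
move=> H T Tb T1 TE Tu _.
have [linT _] := Tb.
have contrT x : nm (T x) <= nm x.
  by apply: le_trans (nm_le_opnorm _ _ T x Tb) _; rewrite ler_piMl ?nm_ge0.
(* [0] is off the unit circle, hence outside the spectrum. *)
have T_inv : invertible_op T.
  have -> : T = (fun x => T x - 0 *: x) by apply/funext => x; rewrite scale0r subr0.
  apply: contrapT => /(TE 0)/E_circle /eqP.
  by rewrite normr0 eq_sym oner_eq0.
(* Since an inverse exists, [inverse_op T] is not the default [id]. *)
have : is_inverse T (inverse_op T) by exact: xgetPex T_inv.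
move: Tu; set S := inverse_op T => Su invS; have [Sb TS ST] := invS.
have Sib n := bounded_op_iter _ _ S n Sb.
have u1 n : 1 <= (u n)%:R :> R by rewrite ler1n.
(* The estimate in [Su] holds from some [n0] on; the finitely many earlier norms go into [B], as
   [u n >= 1]. *)
have [C C0 SC] : exists2 C, 0 <= C & forall n, opnorm (iter n S) <= C * (u n)%:R.
  move/eqO_exP : Su => [c [c0 [n0 _ cS]]].
  pose B := \sum_(n < n0) opnorm (iter n S).
  have B0 : 0 <= B by apply: sumr_ge0 => n _; exact: opnorm_ge0.
  exists (c + B) => [|n]; first by rewrite addr_ge0// ltW.
  have [nn0|nn0] := ltnP n n0.
    apply: (@le_trans _ _ B).
      rewrite /B (bigD1 (Ordinal nn0))//= lerDl sumr_ge0// => i _.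
      exact: opnorm_ge0.
    have := u1 n; nra.
  have := cS n nn0; rewrite /= ger0_norm ?opnorm_ge0// [`|(u n)%:R|]ger0_norm// => h.
  by apply: le_trans h _; rewrite ler_wpM2r// lerDl.
(* It remains to see that [T] preserves norms. A strict loss [q0] at [x] is refuted because the loss
   is the coefficient at index [0], which vanishes. *)
apply: (unitary_of_isometry _ T S) => // x.
apply/eqP; rewrite -(eqrXn2 (n := 2))// ?nm_ge0// eq_sym -subr_eq0.
have := defect_ge0 R H T contrT x; rewrite le_eqVlt eq_sym => /orP[//|q0].
have Sv n : nm (iter n S x) <= C * (u n)%:R * nm x.
  by apply: le_trans (nm_le_opnorm _ _ _ x (Sib n)) _; rewrite ler_wpM2r ?nm_ge0.
suff : nm x ^+ 2 - nm (T x) ^+ 2 = 0 by move/eqP.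
apply: (@complexI R); rewrite -defectE.
apply: (null_support_coef0 R E u (fun k => defect T (orbit R H T S x k) x) _
  u_gt0 u8 u_slow
  (sum_defect_bound R H T S linT contrT ST x (fun n => (u n)%:R) C u1 C0 Sv q0)).
move=> M M0.
(* There are finitely many arcs, and on each one missing [E] the resolvent bound holds for all large
   [rho], so a single [rho] serves them all. *)
have : \forall rho \near +oo, 0 <= rho /\ forall p : 'I_M, ~~ arc_meets E M p ->
    forall t, arc_end M p <= t <= arc_end M p.+1 ->
    forall y, nm y <= rho * nm (T y - expi t *: y).
  near=> rho; split; first by near: rho; apply: nbhs_pinfty_ge; rewrite num_real.
  near: rho; apply: filter_forall => p.
  have [_|np] := boolP (arc_meets E M p); first by near=> rho.
  have := resolvent_below_arc _ _ T (arc_end M p) (arc_end M p.+1) E Tb TE _.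
  move=> /(_ _)/filterS; apply => [rho hrho _ //|t tp Et].
  by move/negP : np; apply; apply/asboolP; exists t.
move=> /filter_ex[rho [rho0 below]].
exists (rho ^+ 2 * ((C + 3) * nm x) * Num.sqrt (nm x ^+ 2 - nm (T x) ^+ 2)); split.
  by rewrite !mulr_ge0 ?sqr_ge0 ?nm_ge0 ?sqrtr_ge0// addr_ge0.
move=> p t n pM np tp.
apply: (fejer_defect_bound _ _ _ _ linT contrT ST x (fun n => (u n)%:R)) => //.
  exact: nm_expi.
exact: (below (Ordinal pM)).
Unshelve. all: by end_near. Qed.
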